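(* There is a weight-halving bijection from $[\mathcal{D}_{o}\times\mathcal{D}_{o}\times\mathcal{D}\times\mathcal{D}]_{\mathsf{even}}$ to $\mathcal{D}_{o}\times\mathcal{D}_{o}\times\mathcal{D}_{o}\times\mathcal{D}_{o}\times\mathcal{D}\times\mathcal{D}\times\mathcal{D}\times\mathcal{D}$. As a consequence, the numbers $P_{1^{-4}2^{6}4^{-2}}(n)$ defined by $\sum_{n\ge0}P_{1^{-4}2^{6}4^{-2}}(n)q^n=\frac{f_2^6}{f_1^4f_4^2}$ form a $2$-convolutive sequence, i.e. $\sum_{n\ge0}P_{1^{-4}2^{6}4^{-2}}(2n)q^n=\big(\sum_{n\ge0}P_{1^{-4}2^{6}4^{-2}}(n)q^n\big)^2$.
   Context: A partition is a non-increasing finite sequence of positive integers (parts); its weight is the sum of its parts. $\mathcal{D}$ denotes the set of partitions into distinct parts, and $\mathcal{D}_{o}$ the set of partitions into distinct odd parts. The weight of a tuple of partitions is the sum of the weights of its components. For a set $\mathcal{U}$ of weighted objects, $[\mathcal{U}]_{\mathsf{even}}$ is the subset of members of even weight. A bijection is weight-halving if the weight of the image is half the weight of the object. $f_i:=(q^i;q^i)_\infty=\prod_{k\ge1}(1-q^{ik})$. A sequence $(a_n)_{n\ge0}$ is $m$-convolutive if $\sum_{n\ge0}a_{mn}q^n=\big(\sum_{n\ge0}a_nq^n\big)^m$. *)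

(* Defs.v *)
From mathcomp Require Import all_boot all_algebra.
Set Implicit Arguments. Unset Strict Implicit. Unset Printing Implicit Defensive.
Import GRing.Theory.

Definition is_part (s : seq nat) : bool :=
  sorted geq s && all (fun x => 0 < x) s.
Definition is_dpart (s : seq nat) : bool := is_part s && uniq s.
Definition is_dopart (s : seq nat) : bool := is_dpart s && all odd s.

Definition Dpart := {s : seq nat | is_dpart s}.
Definition Dopart := {s : seq nat | is_dopart s}.

Definition wD (p : Dpart) : nat := sumn (val p).
Definition wDo (p : Dopart) : nat := sumn (val p).

Definition wt4 (x : Dopart * Dopart * Dpart * Dpart) : nat :=
  let: (a, b, c, d) := x in wDo a + wDo b + wD c + wD d.
Definition Src := {x : Dopart * Dopart * Dpart * Dpart | ~~ odd (wt4 x)}.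

Definition Tgt :=
  (Dopart * Dopart * Dopart * Dopart * Dpart * Dpart * Dpart * Dpart)%type.
Definition wt8 (y : Tgt) : nat :=
  let: (a1, a2, a3, a4, b1, b2, b3, b4) := y in
  wDo a1 + wDo a2 + wDo a3 + wDo a4 + wD b1 + wD b2 + wD b3 + wD b4.

Local Open Scope ring_scope.
Definition ser := nat -> int.
Definition sone : ser := fun n => (n == 0%N)%:R.
Definition smul (a b : ser) : ser :=
  fun n => \sum_(i < n.+1) a i * b (n - i)%N.
Definition spow (a : ser) (m : nat) : ser := iter m (smul a) sone.
Definition sfac (k : nat) : ser := fun n => (n == 0%N)%:R - (n == k)%:R.
(* 1/(1 - q^k) = sum_j q^(k j), for k >= 1 *)
Definition sinvfac (k : nat) : ser := fun n => (k %| n)%:R.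

(* k-th factor of f_2^6 / (f_1^4 f_4^2):
   (1-q^{2k})^6 (1-q^k)^{-4} (1-q^{4k})^{-2}; it is 1 + O(q^k). *)
Definition Gfac (k : nat) : ser :=
  smul (spow (sfac (2 * k)) 6)
       (smul (spow (sinvfac k) 4) (spow (sinvfac (4 * k)) 2)).

(* P_{1^{-4}2^6 4^{-2}}(n): the n-th coefficient of the infinite product,
   computed from the finite product over k = 1..n (factors with k > n
   do not affect the coefficient of q^n). *)
Definition P1246 (n : nat) : int :=
  (\big[smul/sone]_(1 <= k < n.+1) Gfac k) n.

Definition convolutive (m : nat) (a : ser) : Prop :=
  forall n : nat, a (m * n)%N = spow a m n.

(* Main.v *)
(* Let O = prod (1 + q^(2i-1)), D = prod (1 + q^k) and Q = prod (1 - q^k) be the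
   generating functions of D_o, of D, and the Euler product.  The source and
   the target have generating functions F = O^2 D^2 = f_2^6 / (f_1^4 f_4^2) and
   F^2, so everything reduces to "the even part of F(q) is F(q^2)^2", and
   the bijection is then obtained by matching finite weight classes of equal
   size.  Since D(q) = O(q) D(q^2), only the even part of O^4 matters.  Jacobi's
   triple product gives O^2 Q(q^2) = theta, where theta = sum_n q^(n^2), and
   (a, b) |-> ((a + b) / 2, (a - b) / 2) shows that the even part of
   theta(q)^2 is theta(q^2)^2.  As Q(q^2) = Q D, cancelling Q^2 shows that the
   even part of O^4, with q^2 replaced by q, is O^4 D^2.

   Power series are handled as integer polynomials modulo X^K, each infinite
   product being cut at an index large compared with K. *)

Require Import Defs.
From mathcomp Require Import all_boot all_algebra.
From mathcomp Require Import zify ring.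
From Stdlib Require Import Setoid Morphisms.

Set Implicit Arguments. Unset Strict Implicit. Unset Printing Implicit Defensive.
Import GRing.Theory.
Local Open Scope ring_scope.

(** * Gaussian binomial coefficients *)

Section GaussianBinomial.
Variables (R : comNzRingType) (t : R).

Fixpoint gauss (m k : nat) : R :=
  match m, k with
  | _, 0%N => 1
  | 0%N, _.+1 => 0
  | m'.+1, k'.+1 => gauss m' k'.+1 + t ^+ (m' - k') * gauss m' k'
  end.

(** The q-Pochhammer symbol (t;t)_m. *)
Definition qfact (m : nat) : R := \prod_(i < m) (1 - t ^+ i.+1).

Lemma gauss0 m : gauss m 0 = 1. Proof. by case: m. Qed.

Lemma gaussS m k :
  gauss m.+1 k.+1 = gauss m k.+1 + t ^+ (m - k) * gauss m k.
Proof. by []. Qed.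

Lemma gauss_small m k : (m < k)%N -> gauss m k = 0.
Proof.
elim: m k => [|m IHm] [|k] // ltmk.
by rewrite gaussS !IHm ?mulr0 ?addr0 //; lia.
Qed.

Lemma qfactS m : qfact m.+1 = qfact m * (1 - t ^+ m.+1).
Proof. by rewrite /qfact big_ord_recr. Qed.

(** The quotient formula (t;t)_m / ((t;t)_k (t;t)_(m-k)), cross-multiplied to make sense in any
    commutative ring. *)
Lemma gauss_qfact m k : (k <= m)%N ->
  gauss m k * qfact k * qfact (m - k) = qfact m.
Proof.
elim: m k => [|m IHm] [|k] // lekm; rewrite ?subn0 ?gauss0.
- by rewrite /qfact big_ord0 !mulr1.
- by rewrite {1}/qfact big_ord0 !mul1r.
rewrite subSS gaussS qfactS; case: (ltngtP k m) => [ltkm | | eqkm]; last first.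
- rewrite eqkm subnn gauss_small // expr0 add0r mul1r !qfactS.
  by have := IHm m (leqnn m); rewrite subnn => H; rewrite -[in RHS]H; ring.
- by lia.
have Em : (m - k)%N = (m - k.+1).+1 by lia.
have H1 := IHm k.+1 ltkm; have H2 := IHm k (ltnW ltkm).
rewrite qfactS in H1; rewrite Em qfactS in H2.
have E : t ^+ m.+1 = t ^+ (m - k.+1).+1 * t ^+ k.+1.
  by rewrite -exprD; congr (_ ^+ _); lia.
rewrite Em (qfactS m) (qfactS (m - k.+1)) E.
set x := t ^+ (m - k.+1).+1 in H1 H2 *; set y := t ^+ k.+1 in H1 H2 *.
transitivity (qfact m * (1 - x) + qfact m * x * (1 - y)); last by ring.
by rewrite -{1}H1 -H2; ring.
Qed.

(** The other q-Pascal rule, which puts the power of t on the other term. Expanding both sides by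
    the two rules makes them agree. *)
Lemma gaussS_dual m k :
  gauss m.+1 k.+1 = gauss m k + t ^+ k.+1 * gauss m k.+1.
Proof.
elim: m k => [|m IHm] k.
  by case: k => [|k]; rewrite /= ?expr0; ring.
rewrite gaussS; case: k => [|k].
  rewrite [in LHS]IHm gaussS !gauss0 !subn0 !exprS; ring.
rewrite subSS [in LHS](IHm k.+1) [in LHS](IHm k) (gaussS m k.+1) (gaussS m k).
case: (ltnP k m) => [ltkm | lemk]; last first.
  by rewrite (gauss_small (m := m) (k := k.+1)) //; ring.
have -> : (m - k)%N = (m - k.+1).+1 by lia.
by rewrite !exprS; ring.
Qed.

End GaussianBinomial.

(** * A finite form of Jacobi's triple product *)

Section FiniteTripleProduct.
Variables (R : comNzRingType) (q : R).

Definition oddprod n : R := \prod_(i < n) (1 + q ^+ i.*2.+1).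

Lemma oddprodS n : oddprod n.+1 = oddprod n * (1 + q ^+ n.*2.+1).
Proof. by rewrite /oddprod big_ord_recr. Qed.

(** The square (k - b)^2 in natural numbers: at most one of the truncated differences is nonzero. *)
Definition sqdist k b : nat := ((k - b) + (b - k)) ^ 2.

Lemma sqdist_shiftr a b k : (k <= a + b)%N ->
  (a.*2.+1 + sqdist k b = sqdist k.+1 b + (a + b - k).*2)%N.
Proof.
rewrite /sqdist => le_k; case: (leqP b k) => lebk.
  have -> : (k - b + (b - k) = k - b)%N by lia.
  have -> : (k.+1 - b + (b - k.+1) = (k - b).+1)%N by lia.
  nia.
have -> : (k - b + (b - k) = (b - k.+1).+1)%N by lia.
have -> : (k.+1 - b + (b - k.+1) = b - k.+1)%N by lia.
nia.
Qed.

Lemma sqdist_shiftl b k :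
  (b.*2.+1 + sqdist k.+1 b = sqdist k b + k.+1.*2)%N.
Proof.
rewrite /sqdist; case: (leqP b k) => lebk.
  have -> : (k - b + (b - k) = k - b)%N by lia.
  have -> : (k.+1 - b + (b - k.+1) = (k - b).+1)%N by lia.
  nia.
have -> : (k - b + (b - k) = (b - k.+1).+1)%N by lia.
have -> : (k.+1 - b + (b - k.+1) = b - k.+1)%N by lia.
nia.
Qed.

Let g := gauss (q ^+ 2).

Lemma gauss_sum_recl b m :
  \sum_(k < m.+1) q ^+ sqdist k b * g m k
  = q ^+ (b ^ 2) + \sum_(k < m.+1) q ^+ sqdist k.+1 b * g m k.+1.
Proof.
rewrite [in RHS]big_ord_recr /= /g gauss_small // mulr0 addr0 big_ord_recl.
by rewrite gauss0 mulr1 /sqdist sub0n subn0 add0n.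
Qed.

(** Cauchy's finite form of the triple product at z = 1. Induction on b with a = 0 uses the dual
    q-Pascal rule, induction on a the defining one; the new factor shifts the summation index by
    one. *)
Lemma finite_triple_product a b :
  oddprod a * oddprod b = \sum_(k < (a + b).+1) q ^+ sqdist k b * g (a + b) k.
Proof.
elim: a => [|a IHa].
  elim: b => [|b IHb].
    by rewrite /oddprod !big_ord0 big_ord1 /sqdist /g /= expr0 mulr1.
  rewrite oddprodS mulrA IHb !add0n [in RHS]big_ord_recl /g gauss0 mulr1.
  rewrite mulrDr mulr1; under [X in _ = _ + X]eq_bigr => k _.
    rewrite lift0 gaussS_dual /sqdist !subSS -/(sqdist k b).
    rewrite -exprM mulrDr mulrA -exprD mul2n -sqdist_shiftl exprD -mulrA.
    over.
  rewrite big_split /= -mulr_sumr [X in X * q ^+ _]gauss_sum_recl.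
  rewrite /sqdist sub0n subn0 add0n.
  (* The isolated term q^((b+1)^2) is q^(2b+1) times the term q^(b^2) that the shifted sum lacks. *)
  have -> : (b.+1 ^ 2 = b.*2.+1 + b ^ 2)%N by nia.
  by rewrite exprD; ring.
rewrite oddprodS mulrAC IHa addSn [in RHS]big_ord_recl /g gauss0 mulr1.
rewrite mulrDr mulr1; under [X in _ = _ + X]eq_bigr => k _.
  rewrite lift0 gaussS mulrDr mulrA -exprM -exprD mul2n.
  rewrite -sqdist_shiftr; last by have := ltn_ord k; lia.
  rewrite exprD -mulrA; over.
rewrite big_split /= -mulr_sumr [X in X + _ = _]gauss_sum_recl.
by rewrite /sqdist sub0n subn0 add0n -addrA; congr (_ + (_ + _)); rewrite mulrC.
Qed.

End FiniteTripleProduct.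

(** * Congruence of integer polynomials modulo X^K *)

Section Congruence.
Variable K : nat.

Definition eqmX (p r : {poly int}) := forall i, (i < K)%N -> p`_i = r`_i.

#[local] Instance eqmX_equiv : Equivalence eqmX.
Proof.
split=> [p i // | p r H i ltiK | p r s H1 H2 i ltiK]; first by rewrite H.
by rewrite H1 ?H2.
Qed.

#[local] Instance eqmX_mul : Proper (eqmX ==> eqmX ==> eqmX) *%R.
Proof.
move=> p p' Hp r r' Hr i ltiK; rewrite !coefM; apply: eq_bigr => j _.
by have := ltn_ord j => ltji; rewrite Hp ?Hr //; lia.
Qed.

#[local] Instance eqmX_exp : Proper (eqmX ==> eq ==> eqmX) (@GRing.exp _).
Proof.
move=> p p' Hp n _ <-; elim: n => [|n IHn]; first by rewrite !expr0.
by rewrite !exprS; apply: eqmX_mul.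
Qed.

Lemma eqmX_sum (I : Type) (s : seq I) (P : pred I) (F G : I -> {poly int}) :
  (forall i, P i -> eqmX (F i) (G i)) ->
  eqmX (\sum_(i <- s | P i) F i) (\sum_(i <- s | P i) G i).
Proof.
by move=> FG j ltjK; rewrite !coef_sum; apply: eq_bigr => i Pi; apply: FG.
Qed.

Lemma eqmX_prod (I : Type) (s : seq I) (P : pred I) (F G : I -> {poly int}) :
  (forall i, P i -> eqmX (F i) (G i)) ->
  eqmX (\prod_(i <- s | P i) F i) (\prod_(i <- s | P i) G i).
Proof. by move=> FG; apply: big_ind2 => // *; apply: eqmX_mul. Qed.

(** Since s has constant term 1, coefficient i of a product with s determines coefficient i of the
    other factor once the lower ones are known. *)
Lemma eqmX_cancel (p r s : {poly int}) :
  s`_0 = 1 -> eqmX (p * s) (r * s) -> eqmX p r.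
Proof.
move=> s0 H; elim/ltn_ind => i IHi ltiK.
have := H i ltiK; rewrite !coefM !big_ord_recr /= subnn s0 !mulr1.
rewrite (eq_bigr (fun j : 'I_i => r`_j * s`_(i - j))) => [/addrI // | j _].
by rewrite IHi // (ltn_trans _ ltiK).
Qed.

Lemma eqmX_Xn n : (K <= n)%N -> eqmX 'X^n 0.
Proof. by move=> leKn i ltiK; rewrite coefXn coef0; case: eqP => //; lia. Qed.

(** Factors 1 - X^(c j) with j >= K are 1 modulo X^K, so the product is stationary from K - 1
    factors on. *)
Lemma eqmX_qfact c m : (0 < c)%N -> (K <= m.+1)%N ->
  eqmX (qfact 'X^c m) (qfact 'X^c K.-1).
Proof.
move=> c_gt0; elim: m => [|m IHm] leKm; first by have -> : K.-1 = 0%N by lia.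
case: (ltngtP K m.+2) leKm => // [ltKm _ | -> //].
rewrite qfactS -[X in eqmX _ X]mulr1 IHm //; apply: eqmX_mul => // i ltiK.
rewrite -exprM coefB coefXn; case: eqP; rewrite ?subr0 // => Ei.
by move: ltiK ltKm; rewrite Ei; nia.
Qed.

End Congruence.

#[local] Existing Instances eqmX_equiv eqmX_mul eqmX_exp.

Lemma qfact_coef0 c m : (0 < c)%N -> (qfact ('X^c : {poly int}) m)`_0 = 1.
Proof.
move=> c_gt0; rewrite -horner_coef0 /qfact horner_prod big1 // => i _.
by rewrite !hornerE /= expr0n; case: c c_gt0 => // c _; rewrite expr0n /= subr0.
Qed.

(** * The theta series and the even part of its square *)

(** The sum of q^(j^2) over -N <= j <= N, indexed by k = j + N. *)
Definition theta N : {poly int} := \sum_(k < (N + N).+1) 'X^(sqdist k N).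

(** In the finite triple product with a = b = N, terms with (k - N)^2 >= K vanish modulo X^K; for
    the others the Gaussian binomial is inverse to (q^2;q^2)_N modulo X^K. *)
Lemma triple_product_modX K N : (2 * K <= N)%N ->
  eqmX K (oddprod 'X N ^+ 2 * qfact 'X^2 N) (theta N).
Proof.
move=> leKN; rewrite expr2 finite_triple_product mulr_suml.
apply: eqmX_sum => k _; have := ltn_ord k => ltkN.
case: (leqP K (sqdist k N)) => ltKd.
  by rewrite eqmX_Xn // !mul0r.
rewrite -[X in eqmX _ _ X]mulr1 -mulrA; apply: eqmX_mul => //.
(* Here |k - N| < K and 2K <= N, so k is far from both ends and all q-factorials involved are
   stationary. *)
have [leKk leKk'] : (K <= k)%N /\ (K <= N + N - k)%N.
  by move: ltKd; rewrite /sqdist; nia.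
(* A second q-factorial is multiplied in so that the quotient formula applies. *)
apply: (@eqmX_cancel _ _ _ (qfact 'X^2 N)); first exact: qfact_coef0.
rewrite mul1r [X in eqmX _ _ X](eqmX_qfact (c := 2)) //; last by lia.
have <- := eqmX_qfact (c := 2) (K := K) (m := N + N) isT; last by lia.
rewrite -(gauss_qfact ('X^2) (m := N + N) (k := k)); last by lia.
rewrite (eqmX_qfact (c := 2) (m := N)) //; last by lia.
rewrite (eqmX_qfact (c := 2) (m := k)) //; last by lia.
by rewrite (eqmX_qfact (c := 2) (m := N + N - k)) //; lia.
Qed.

Lemma sqdistE k b : (sqdist k b)%:Z = (k%:Z - b%:Z) ^+ 2.
Proof.
by rewrite /sqdist; case: (leqP b k) => H; nia.
Qed.

(** With a = c - N and b = d - N this is (a + b)^2 + (a - b)^2 = 2 (a^2 + b^2). *)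
Lemma sqdist_rotate N c d k l : (k + N = c + d)%N -> (l + d = c + N)%N ->
  (sqdist k N + sqdist l N = 2 * (sqdist c N + sqdist d N))%N.
Proof.
move=> Ek El; apply/eqP; rewrite -eqz_nat PoszM !PoszD !sqdistE; apply/eqP.
have -> : k%:Z - N%:Z = (c%:Z - N%:Z) + (d%:Z - N%:Z) by lia.
have -> : l%:Z - N%:Z = (c%:Z - N%:Z) - (d%:Z - N%:Z) by lia.
by ring.
Qed.

Lemma two_squares_double N n k l :
  (2 * n < N)%N -> (k <= N + N)%N -> (l <= N + N)%N ->
  (sqdist k N + sqdist l N = 2 * n)%N ->
  let c := (k + l)./2 in let d := (k + (N + N) - l)./2 in
  [/\ (c <= N + N)%N, (d <= N + N)%N, (sqdist c N + sqdist d N = n)%N,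
      (c + d - N = k)%N & (c + N - d = l)%N].
Proof.
move=> ltnN lek lel E c d.
have Hk : (k - N + (N - k) < N)%N by move: E; rewrite /sqdist; nia.
have Hl : (l - N + (N - l) < N)%N by move: E; rewrite /sqdist; nia.
(* A square has the parity of its root, so an even sum of squares makes both halvings exact. *)
have Ekl : ~~ odd (k + l).
  have : ~~ odd (sqdist k N + sqdist l N) by rewrite E; lia.
  by rewrite /sqdist oddD !oddX /=; lia.
have Ec : (c.*2 = k + l)%N by rewrite /c; lia.
have Ed : (d.*2 = k + (N + N) - l)%N by rewrite /d; lia.
split; try lia.
by have := @sqdist_rotate N c d k l; lia.
Qed.

Lemma two_squares_half N n c d :
  (2 * n < N)%N -> (c <= N + N)%N -> (d <= N + N)%N ->
  (sqdist c N + sqdist d N = n)%N ->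
  let k := (c + d - N)%N in let l := (c + N - d)%N in
  [/\ (k <= N + N)%N, (l <= N + N)%N, (sqdist k N + sqdist l N = 2 * n)%N,
      ((k + l)./2 = c)%N & ((k + (N + N) - l)./2 = d)%N].
Proof.
move=> ltnN lec led E k l.
(* Both c and d lie within N/2 of N, so the subtractions in k and l are not truncated and k, l stay
   at most 2N. *)
have Hc : (2 * (c - N + (N - c)) < N)%N by move: E; rewrite /sqdist; nia.
have Hd : (2 * (d - N + (N - d)) < N)%N by move: E; rewrite /sqdist; nia.
have Ek : (k + N = c + d)%N by rewrite /k; lia.
have El : (l + d = c + N)%N by rewrite /l; lia.
split; try lia.
by have := @sqdist_rotate N c d k l; lia.
Qed.

Lemma coef_theta_sqr N n :
  (theta N ^+ 2)`_n =
  \sum_(x : 'I_(N + N).+1 * 'I_(N + N).+1 | sqdist x.1 N + sqdist x.2 N == n) 1.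
Proof.
rewrite expr2 /theta mulr_suml coef_sum.
under eq_bigr => k _ do rewrite mulr_sumr coef_sum.
rewrite pair_bigA /= [RHS]big_mkcond /=; apply: eq_bigr => x _.
by rewrite -exprD coefXn eq_sym; case: eqP.
Qed.

(* The rotation (a, b) |-> ((a + b) / 2, (a - b) / 2) of the square lattice
   halves a^2 + b^2; here the coordinates are shifted by N. *)
Lemma even_theta_sqr K N : (2 * K <= N)%N ->
  eqmX K (even_poly (theta N ^+ 2)) (theta N ^+ 2).
Proof.
move=> leKN n ltnK; rewrite coef_even_poly !coef_theta_sqr.
have ltnN : (2 * n < N)%N by lia.
pose I := 'I_(N + N).+1.
pose h (x : I * I) : I * I := (inord (x.1 + x.2 - N), inord (x.1 + N - x.2)).
pose h' (x : I * I) : I * I :=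
  (inord (x.1 + x.2)./2, inord (x.1 + (N + N) - x.2)./2).
have hh' (x : I * I) : (sqdist x.1 N + sqdist x.2 N == n.*2)%N ->
  (sqdist (h' x).1 N + sqdist (h' x).2 N = n)%N /\ h (h' x) = x.
  case: x => k l /= /eqP; rewrite -mul2n => E.
  have [] := two_squares_double ltnN _ _ E; rewrite -1?ltnS // => H1 H2 H3 H4 H5.
  by rewrite /h /h' /= !inordK //; split=> //; congr (_, _); apply: val_inj;
    rewrite /= inordK ?H4 ?H5.
have h'h (x : I * I) : (sqdist x.1 N + sqdist x.2 N == n)%N ->
  (sqdist (h x).1 N + sqdist (h x).2 N = n.*2)%N /\ h' (h x) = x.
  case: x => c d /= /eqP E.
  have [] := two_squares_half ltnN _ _ E; rewrite -1?ltnS // => H1 H2 H3 H4 H5.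
  by rewrite /h /h' /= !inordK // -mul2n; split=> //; congr (_, _); apply: val_inj;
    rewrite /= inordK ?H4 ?H5.
(* From here on only the inverse properties of [h] and [h'] matter, not their formulas. *)
move: h h' hh' h'h => h h' hh' h'h.
rewrite (reindex_onto h h'); last by move=> x /hh' [].
apply: eq_bigl => x; apply/idP/idP => [/andP[Hx /eqP E] | Hx].
  by have [H _] := hh' _ Hx; rewrite E in H; apply/eqP.
by have [H ->] := h'h _ Hx; rewrite eqxx andbT; apply/eqP.
Qed.

(** A factor in q^2 preserves parity of exponents, so it leaves the even part; [even_poly] also
    replaces q^2 by q, which turns r(q^2) into r(q). *)
Lemma even_poly_mul_comp (p r : {poly int}) :
  even_poly (p * (r \Po 'X^2)) = even_poly p * r.
Proof.
have E s : even_poly (s \Po 'X^2) = s :> {poly int}.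
  apply/polyP => i; rewrite coef_even_poly coef_comp_poly_Xn // -mul2n.
  by rewrite dvdn_mulr // mulKn.
have O s : odd_poly (s \Po 'X^2) = 0 :> {poly int}.
  apply/polyP => i; rewrite coef_odd_poly coef_comp_poly_Xn // coef0.
  by rewrite dvdn2 /= odd_double.
rewrite -{1}(poly_even_odd p) mulrDl -comp_polyM mulrAC -comp_polyM.
by rewrite even_polyD even_polyMX E O mul0r addr0.
Qed.

Lemma eqmX_even K p r : eqmX K.*2 p r -> eqmX K (even_poly p) (even_poly r).
Proof. by move=> H i ltiK; rewrite !coef_even_poly H // ltn_double. Qed.

(** * The product over distinct parts and the key even-part identity *)

Section DistinctProduct.
Variables (R : comNzRingType) (q : R).

Definition dprod n : R := \prod_(i < n) (1 + q ^+ i.+1).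

Lemma qfact_sqr n : qfact (q ^+ 2) n = qfact q n * dprod n.
Proof.
rewrite /qfact /dprod -big_split; apply: eq_bigr => i _ /=.
by rewrite -exprM mulnC exprM; ring.
Qed.

End DistinctProduct.

(** Exponents up to 2n are separated into odd and even ones. *)
Lemma dprod_double (R : comNzRingType) (q : R) n :
  dprod q n.*2 = oddprod q n * dprod (q ^+ 2) n.
Proof.
elim: n => [|n IHn]; first by rewrite /dprod /oddprod !big_ord0 mulr1.
rewrite oddprodS /dprod doubleS !big_ord_recr /= -!/(dprod _ _) IHn.
by rewrite -exprM mul2n doubleS; ring.
Qed.

Lemma qfact_comp_X2 n : qfact 'X^2 n = qfact 'X n \Po 'X^2 :> {poly int}.
Proof.
rewrite /qfact rmorph_prod; apply: eq_bigr => i _ /=.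
by rewrite comp_polyB comp_polyC comp_Xn_poly.
Qed.

Lemma dprod_comp_X2 n : dprod 'X^2 n = dprod 'X n \Po 'X^2 :> {poly int}.
Proof.
rewrite /dprod rmorph_prod; apply: eq_bigr => i _ /=.
by rewrite comp_polyD comp_polyC comp_Xn_poly.
Qed.

Lemma eqmX_qfact2 K c m n : (0 < c)%N -> (K <= m.+1)%N -> (K <= n.+1)%N ->
  eqmX K (qfact 'X^c m) (qfact 'X^c n).
Proof. by move=> c_gt0 leKm leKn; rewrite eqmX_qfact // -eqmX_qfact. Qed.

(** D(q) is Q(q^2) / Q(q), so it inherits stationarity from the q-factorials. *)
Lemma eqmX_dprod K m n : (K <= m.+1)%N -> (K <= n.+1)%N ->
  eqmX K (dprod 'X m) (dprod 'X n).
Proof.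
move=> leKm leKn; apply: (@eqmX_cancel _ _ _ (qfact 'X^1 n)).
  exact: qfact_coef0.
rewrite -{1}(eqmX_qfact2 (m := m)) // expr1 !(mulrC (dprod _ _)) -!qfact_sqr.
exact: eqmX_qfact2.
Qed.

(** The identity behind both claims: the even part of F(q) is F(q^2)^2. The N odd factors reach
    exponent 2N - 1, so D is cut at 2N and its splitting into odd and even exponents is exact. *)
Lemma even_oddprod_dprod K N : (4 * K <= N)%N ->
  eqmX K (even_poly (oddprod 'X N ^+ 2 * dprod 'X N.*2 ^+ 2))
         (oddprod 'X N ^+ 4 * dprod 'X N.*2 ^+ 4).
Proof.
move=> leKN; set O : {poly int} := oddprod 'X N.
set D : {poly int} := dprod 'X N; set Q : {poly int} := qfact 'X N.
have evenO4 : eqmX K (even_poly (O ^+ 4)) (O ^+ 4 * D ^+ 2).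
  apply: (@eqmX_cancel _ _ _ (Q ^+ 2)).
    by rewrite -horner_coef0 horner_exp horner_coef0 /Q -['X]expr1 qfact_coef0 ?expr1n.
  rewrite -even_poly_mul_comp rmorphXn /= -qfact_comp_X2.
  have E : O ^+ 4 * qfact 'X^2 N ^+ 2 = (O ^+ 2 * qfact 'X^2 N) ^+ 2 by ring.
  have -> : O ^+ 4 * D ^+ 2 * Q ^+ 2 = (O ^+ 2 * qfact 'X^2 N) ^+ 2.
    by rewrite qfact_sqr -/Q -/D; ring.
  (* Used with L = 2K under the even part, which halves the precision, and with L = K on the other
     side; hence the bound 4K <= N. *)
  have T L : (2 * L <= N)%N ->
      eqmX L ((O ^+ 2 * qfact 'X^2 N) ^+ 2) (theta N ^+ 2).
    by move=> leLN; rewrite triple_product_modX.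
  rewrite E; transitivity (theta N ^+ 2); last by symmetry; apply: T; lia.
  transitivity (even_poly (theta N ^+ 2)); last by apply: even_theta_sqr; lia.
  by apply: eqmX_even; apply: T; lia.
have -> : O ^+ 2 * dprod 'X N.*2 ^+ 2 = O ^+ 4 * (D ^+ 2 \Po 'X^2).
  by rewrite dprod_double rmorphXn /= -dprod_comp_X2 -/O; ring.
rewrite even_poly_mul_comp evenO4 (eqmX_dprod (m := N.*2) (n := N)); try lia.
by rewrite -/D -mulrA -exprD.
Qed.

(** * From formal series to polynomials: the eta quotient and its convolutivity *)

Section SeriesTruncation.
Variable K : nat.

Definition strunc (a : ser) : {poly int} := \poly_(i < K) a i.

Lemma strunc_mul a b : eqmX K (strunc (smul a b)) (strunc a * strunc b).
Proof.
move=> i ltiK; rewrite coef_poly ltiK coefM; apply: eq_bigr => j _.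
have := ltn_ord j => ltji; rewrite !coef_poly.
have -> : (j < K)%N by lia.
by have -> : (i - j < K)%N by lia.
Qed.

Lemma strunc_one : eqmX K (strunc sone) 1.
Proof. by move=> i ltiK; rewrite coef_poly ltiK coef1. Qed.

Lemma strunc_pow a m : eqmX K (strunc (spow a m)) (strunc a ^+ m).
Proof.
elim: m => [|m IHm]; first exact: strunc_one.
by rewrite exprS -IHm; apply: strunc_mul.
Qed.

Lemma strunc_prod (I : Type) (s : seq I) (F : I -> ser) :
  eqmX K (strunc (\big[smul/sone]_(i <- s) F i)) (\prod_(i <- s) strunc (F i)).
Proof.
elim: s => [|i s IHs]; first by rewrite !big_nil; apply: strunc_one.
by rewrite !big_cons strunc_mul IHs.
Qed.

Lemma strunc_fac c : eqmX K (strunc (sfac c)) (1 - 'X^c).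
Proof. by move=> i ltiK; rewrite coef_poly ltiK coefB coef1 coefXn. Qed.

(** The geometric series telescopes: c divides i exactly when it divides i - c, for i >= c. *)
Lemma strunc_invfac c : (0 < c)%N -> eqmX K (strunc (sinvfac c) * (1 - 'X^c)) 1.
Proof.
move=> c_gt0 i ltiK; rewrite mulrBr mulr1 coefB coefMXn !coef_poly ltiK coef1.
rewrite /sinvfac; case: (ltnP i c) => [ltic | leci].
  case: i ltiK ltic => [|i] ltiK ltic; first by rewrite dvdn0 subr0.
  by rewrite gtnNdvd // subr0.
have -> : (i - c < K)%N by lia.
rewrite -{1}(subnK leci) dvdn_addl // subrr.
by case: i leci ltiK => //; lia.
Qed.

Lemma strunc_Gfac k : (0 < k)%N ->
  eqmX K (strunc (Gfac k) * ((1 - 'X^k) ^+ 4 * (1 - 'X^(4 * k)) ^+ 2))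
         ((1 - 'X^(2 * k)) ^+ 6).
Proof.
move=> k_gt0; rewrite /Gfac !(strunc_mul, strunc_pow) strunc_fac.
set I := strunc _; set J := strunc _; set A := 1 - 'X^(_ * k).
have -> : A ^+ 6 * (I ^+ 4 * J ^+ 2) * ((1 - 'X^k) ^+ 4 * (1 - 'X^(4 * k)) ^+ 2)
  = A ^+ 6 * (I * (1 - 'X^k)) ^+ 4 * (J * (1 - 'X^(4 * k))) ^+ 2 by ring.
by rewrite !strunc_invfac ?muln_gt0 // !expr1n !mulr1.
Qed.

End SeriesTruncation.

Lemma prod_qfact c n :
  \prod_(1 <= k < n.+1) (1 - 'X^(c * k)) = qfact 'X^c n :> {poly int}.
Proof.
rewrite big_add1 /= big_mkord; apply: eq_bigr => i _.
by rewrite exprM.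
Qed.

(** O^2 D^2 = f_2^6 / (f_1^4 f_4^2), checked after multiplying by f_1^4 f_4^2, which has constant
    term 1. *)
Lemma P1246_coef N n : (n <= N)%N ->
  P1246 n = (oddprod 'X N ^+ 2 * dprod 'X N.*2 ^+ 2)`_n.
Proof.
move=> lenN; pose S := \big[smul/sone]_(1 <= k < n.+1) Gfac k.
have -> : P1246 n = (strunc n.+1 S)`_n by rewrite coef_poly ltnSn.
pose Q c : {poly int} := qfact 'X^c N.
suff : eqmX n.+1 (strunc n.+1 S) (oddprod 'X N ^+ 2 * dprod 'X N.*2 ^+ 2).
  by apply.
apply: (@eqmX_cancel _ _ _ (Q 1%N ^+ 4 * Q 4 ^+ 2)).
  by rewrite coef0M -!horner_coef0 !horner_exp !horner_coef0 !qfact_coef0 ?expr1n.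
transitivity (Q 2 ^+ 6).
  rewrite /Q -!(eqmX_qfact2 (m := n) (n := N)) // -!prod_qfact -!prodrXl.
  rewrite strunc_prod -!big_split /= [X in eqmX _ X]big_nat [X in eqmX _ _ X]big_nat.
  apply: eqmX_prod => k /andP[k_gt0 _]; rewrite mul1n.
  exact: strunc_Gfac.
have E4 : Q 4 = Q 2 * dprod 'X^2 N by rewrite /Q -qfact_sqr -exprM.
(* As f_4 = f_2 D(q^2) and O(q) D(q^2) = D(q), the product is f_2^2 (D f_1)^4, and D f_1 = f_2. *)
have -> : oddprod 'X N ^+ 2 * dprod 'X N.*2 ^+ 2 * (Q 1%N ^+ 4 * Q 4 ^+ 2)
  = (Q 2) ^+ 2 * (dprod 'X N.*2 * Q 1%N) ^+ 4.
  by rewrite E4 dprod_double; ring.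
rewrite (eqmX_dprod (m := N.*2) (n := N)); try lia.
by rewrite /Q expr1 [_ * qfact _ _]mulrC -qfact_sqr -exprD.
Qed.

Lemma P1246_convolutive : convolutive 2 P1246.
Proof.
(* The cut required by the even-part identity at precision K = n + 1; it also exceeds 2n. *)
move=> n; pose N := (4 * n.+1)%N.
pose F : {poly int} := oddprod 'X N ^+ 2 * dprod 'X N.*2 ^+ 2.
rewrite (@P1246_coef N); last by rewrite /N; lia.
rewrite mul2n -coef_even_poly (even_oddprod_dprod (K := n.+1)) //.
have -> : oddprod 'X N ^+ 4 * dprod 'X N.*2 ^+ 4 = F ^+ 2 :> {poly int}.
  by rewrite /F; ring.
have : eqmX n.+1 (strunc n.+1 (spow P1246 2)) (F ^+ 2).
  rewrite strunc_pow; apply: eqmX_exp => // i ltin.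
  by rewrite coef_poly ltin; apply: P1246_coef; rewrite /N; lia.
by move/(_ n (ltnSn n)); rewrite coef_poly ltnSn.
Qed.

(** * Counting weighted objects and matching weight classes *)

(* The objects of weight at most N all occur in the list s, so that the
   coefficients of P up to degree N count objects by weight. *)
Definition listing (A : eqType) (w : A -> nat) N (s : seq A) (P : {poly int}) :=
  [/\ uniq s, forall x, (w x <= N)%N -> x \in s & \sum_(x <- s) 'X^(w x) = P].

Lemma listing_count (A : eqType) (w : A -> nat) N s P n :
  listing w N s P -> (count (fun x => w x == n) s)%:R = P`_n.
Proof.
case=> _ _ <-; rewrite coef_sum -sum1_count natr_sum [LHS]big_mkcond /=.
by apply: eq_bigr => x _; rewrite coefXn eq_sym; case: eqP.
Qed.

(** If a pair has weight at most N, so does each component; hence the product list misses no such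
    pair, and the generating polynomials multiply. *)
Lemma listing_pair (A B : eqType) (w : A -> nat) (v : B -> nat) N s t P Q :
  listing w N s P -> listing v N t Q ->
  listing (fun x : A * B => w x.1 + v x.2)%N N [seq (x, y) | x <- s, y <- t]
    (P * Q).
Proof.
move=> [us ms <-] [ut mt <-]; split.
- by apply: allpairs_uniq => // -[x y] [x' y'] _ _ /= [-> ->].
- move=> [x y] /= lexy; apply/allpairsP; exists (x, y); split=> //=.
    by apply: ms; lia.
  by apply: mt; lia.
rewrite big_allpairs mulr_suml; apply: eq_bigr => x _.
by rewrite mulr_sumr; apply: eq_bigr => y _; rewrite /= exprD.
Qed.

Lemma listing_eq (A : eqType) (w v : A -> nat) N s P :
  w =1 v -> listing w N s P -> listing v N s P.
Proof.
move=> wv [us ms <-]; split=> // [x|]; first by rewrite -wv; apply: ms.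
by apply: eq_bigr => x _; rewrite wv.
Qed.

Lemma listing_sub (T : eqType) (p : pred T) (S : subEqType p)
    (w : T -> nat) N (s : seq T) P :
  all p s -> uniq s -> (forall x, p x -> (w x <= N)%N -> x \in s) ->
  \sum_(x <- s) 'X^(w x) = P ->
  listing (fun x : S => w (val x)) N (pmap insub s) P.
Proof.
move=> /all_filterP ps us ms <-; split.
- exact: pmap_sub_uniq.
- by move=> x lewx; rewrite mem_pmap_sub; apply: ms => //; apply: valP.
by rewrite -(big_map val xpredT (fun y => 'X^(w y))) (pmap_filter (insubK _))
  (eq_filter (isSome_insub _)) ps.
Qed.

(** Objects of weight n are matched by their position in two lists of equal length; [a0] and [b0]
    are only default values for [nth]. *)
Lemma bijection_of_counts (A B : eqType) (w : A -> nat) (v : B -> nat)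
    (a0 : A) (b0 : B) (s : nat -> seq A) (t : nat -> seq B) :
  (forall n, uniq (s n)) -> (forall n, uniq (t n)) ->
  (forall x, x \in s (w x)) -> (forall y, y \in t (v y)) ->
  (forall n, count (fun x => w x == n) (s n) = count (fun y => v y == n) (t n)) ->
  exists f : A -> B, bijective f /\ forall x, v (f x) = w x.
Proof.
move=> us ut ms mt Est.
pose s' n := [seq x <- s n | w x == n]; pose t' n := [seq y <- t n | v y == n].
have Esz n : size (s' n) = size (t' n) by rewrite !size_filter.
have us' n : uniq (s' n) by rewrite filter_uniq.
have ut' n : uniq (t' n) by rewrite filter_uniq.
have ms' x : x \in s' (w x) by rewrite mem_filter eqxx ms.
have mt' y : y \in t' (v y) by rewrite mem_filter eqxx mt.
pose f x := nth b0 (t' (w x)) (index x (s' (w x))).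
pose g y := nth a0 (s' (v y)) (index y (t' (v y))).
have vf x : v (f x) = w x.
  have : f x \in t' (w x) by rewrite mem_nth // -Esz index_mem.
  by rewrite mem_filter => /andP[/eqP].
have wg y : w (g y) = v y.
  have : g y \in s' (v y) by rewrite mem_nth // Esz index_mem.
  by rewrite mem_filter => /andP[/eqP].
exists f; split=> //; exists g => [x | y].
  by rewrite /g vf /f index_uniq -?Esz ?index_mem // nth_index.
by rewrite /f wg /g index_uniq ?Esz ?index_mem // nth_index.
Qed.

(** * Enumeration of partitions into distinct parts *)

Lemma is_dpartE s : is_dpart s = sorted gtn s && all (fun x => 0 < x)%N s.
Proof. by rewrite gtn_sorted_uniq_geq -andbA andbC. Qed.

Section DistinctParts.
Variable p : pred nat.

(** Partitions into distinct parts at most N that satisfy p, split by whether N occurs; the split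
    mirrors the factor 1 + q^N of the generating product. *)
Fixpoint dparts (N : nat) : seq (seq nat) :=
  if N is N'.+1 then
    dparts N' ++ (if p N then [seq N :: s | s <- dparts N'] else [::])
  else [:: [::]].

Lemma mem_dparts N s : s \in dparts N =
  [&& is_dpart s, all p s & all (fun x => x <= N)%N s].
Proof.
rewrite is_dpartE.
elim: N s => [|N IHN] s /=.
  rewrite mem_seq1; case: s => //= x s; symmetry; apply/negbTE/negP.
  by case/and3P => /and3P[_ x_gt0 _] _ /andP[lex _]; lia.
rewrite mem_cat IHN; case: s => [|x s] //=.
have -> : (x :: s \in (if p N.+1 then [seq N.+1 :: s0 | s0 <- dparts N] else [::]))
    = [&& p N.+1, x == N.+1 & s \in dparts N].
  case: (p N.+1) => //=; apply/mapP/andP => [[s' ms' [-> ->]] | [/eqP -> ms]].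
    by rewrite eqxx.
  by exists s.
rewrite IHN !(path_sortedE (rev_trans ltn_trans)).
(* The head is the largest part, so comparing it with N + 1 decides which half of the list can
   contain the partition. *)
case: (ltngtP x N.+1) => [ltxN | gtxN | ->].
- have lexN : (x <= N)%N by [].
  rewrite andbF orbF lexN /=.
  case gts: (all _ s) => //=; have -> : all (fun y => y <= N.+1)%N s.
    by apply: sub_all gts => y /=; lia.
  have -> // : all (fun y => y <= N)%N s.
  by apply: sub_all gts => y /=; lia.
- have -> : (x <= N)%N = false by lia.
  by rewrite /= !andbF.
rewrite ltnn /= !andbF /=.
have -> : all (gtn N.+1) s = all (fun y => y <= N)%N s by apply: eq_all.
case leN: (all (fun y => y <= N)%N s); rewrite ?andbF //=.
have -> : all (fun y => y <= N.+1)%N s by apply: sub_all leN => y /=; lia.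
by rewrite !andbT; case: (p _); case: (all p s); rewrite ?andbF ?andbT.
Qed.

Lemma dparts_uniq N : uniq (dparts N).
Proof.
elim: N => //= N IHN; rewrite cat_uniq IHN /=; case: (p _) => //=.
rewrite map_inj_uniq ?IHN => [|s t [] //]; rewrite andbT -all_predC.
apply/allP => _ /mapP[s _ ->]; rewrite /= mem_dparts /= ltnn !andbF //.
Qed.

Lemma sum_dparts N : \sum_(s <- dparts N) 'X^(sumn s) =
  \prod_(i < N | p i.+1) (1 + 'X ^+ i.+1) :> {poly int}.
Proof.
elim: N => [|N IHN]; first by rewrite big_seq1 big_ord0.
rewrite [RHS]big_mkcond big_ord_recr -big_mkcond /= -IHN big_cat /=.
case: (p _); last by rewrite big_nil addr0 mulr1.
rewrite big_map mulrDr mulr1 mulr_suml; congr (_ + _).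
by apply: eq_bigr => s _; rewrite /= exprD mulrC.
Qed.

End DistinctParts.

Lemma leq_sumn (s : seq nat) x : x \in s -> (x <= sumn s)%N.
Proof.
elim: s => //= y s IHs; rewrite inE => /predU1P[->|/IHs]; first exact: leq_addr.
by move/leq_trans; apply; apply: leq_addl.
Qed.

Lemma all_leq_sumn (s : seq nat) N : (sumn s <= N)%N -> all (fun x => x <= N)%N s.
Proof. by move=> leN; apply/allP => x /leq_sumn/leq_trans; apply. Qed.

Definition Dparts N : seq Dpart := pmap insub (dparts predT N).
Definition Doparts N : seq Dopart := pmap insub (dparts odd N).

Lemma listing_Dparts N : listing wD N (Dparts N) (dprod 'X N).
Proof.
apply: (@listing_sub _ is_dpart) => [||s ps les|].
- by apply/allP => s; rewrite mem_dparts => /and3P[].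
- exact: dparts_uniq.
- by rewrite mem_dparts ps all_leq_sumn // all_predT.
by rewrite sum_dparts.
Qed.

Lemma oddprod_filter (R : comNzRingType) (q : R) N :
  \prod_(i < N.*2 | odd i.+1) (1 + q ^+ i.+1) = oddprod q N.
Proof.
elim: N => [|N IHN]; first by rewrite /oddprod !big_ord0.
rewrite oddprodS -IHN !(big_mkcond (fun i => odd _)) doubleS !big_ord_recr /=.
by rewrite odd_double /= mulr1.
Qed.

(** N odd factors account for all odd parts up to 2N, whence the doubled bound. *)
Lemma listing_Doparts N : listing wDo N.*2 (Doparts N.*2) (oddprod 'X N).
Proof.
apply: (@listing_sub _ is_dopart) => [||s /andP[ps os] les|].
- by apply/allP => s; rewrite mem_dparts /is_dopart => /and3P[-> ->].
- exact: dparts_uniq.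
- by rewrite mem_dparts ps os all_leq_sumn.
by rewrite sum_dparts oddprod_filter.
Qed.

(** * Source and target tuples, and the weight-halving bijection *)

Definition src_list N : seq (Dopart * Dopart * Dpart * Dpart) :=
  let A := Doparts N in let B := Dparts N in
  [seq (x, y) | x <- [seq (x, y) | x <- [seq (x, y) | x <- A, y <- A],
    y <- B], y <- B].

Lemma listing_src N : listing wt4 N.*2 (src_list N.*2)
  (oddprod 'X N ^+ 2 * dprod 'X N.*2 ^+ 2).
Proof.
have A := listing_Doparts N; have B := listing_Dparts N.*2.
have := listing_pair (listing_pair (listing_pair A A) B) B.
rewrite -!expr2 -mulrA -expr2; apply: listing_eq.
by case=> [[[a b] c] d].
Qed.

Definition tgt_list N : seq Tgt :=
  let A := Doparts N in let B := Dparts N in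
  [seq (x, y) | x <- [seq (x, y) | x <- [seq (x, y) | x <- [seq (x, y) |
     x <- [seq (x, y) | x <- [seq (x, y) | x <- [seq (x, y) |
     x <- A, y <- A], y <- A], y <- A], y <- B], y <- B], y <- B], y <- B].

Lemma listing_tgt N : listing wt8 N.*2 (tgt_list N.*2)
  (oddprod 'X N ^+ 4 * dprod 'X N.*2 ^+ 4).
Proof.
have A := listing_Doparts N; have B := listing_Dparts N.*2.
have := listing_pair (listing_pair (listing_pair (listing_pair (listing_pair
  (listing_pair (listing_pair A A) A) A) B) B) B) B.
set P := (X in listing _ _ _ X).
have -> : oddprod 'X N ^+ 4 * dprod 'X N.*2 ^+ 4 = P by rewrite /P; ring.
by apply: listing_eq; do 7![case]; move=> *.
Qed.

Lemma weight_halving_bijection : exists f : Src -> Tgt,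
  bijective f /\ forall x : Src, (2 * wt8 (f x))%N = wt4 (val x).
Proof.
pose N n := (4 * n.+1)%N.
(* Measuring the source by half its weight turns weight-halving into weight-preserving. *)
pose w (x : Src) := (wt4 (val x))./2.
have wE x : (2 * w x)%N = wt4 (val x).
  by have := valP x; rewrite /w /=; lia.
pose s n : seq Src := pmap insub (src_list (N n).*2).
pose t n := tgt_list (N n).*2.
pose d0 : Dpart := exist _ [::] isT; pose o0 : Dopart := exist _ [::] isT.
pose a0 : Src := exist _ (o0, o0, d0, d0) isT.
pose b0 : Tgt := (o0, o0, o0, o0, d0, d0, d0, d0).
have [|||||f [bij_f vf]] := @bijection_of_counts Src Tgt w wt8 a0 b0 s t.
- by move=> n; apply: pmap_sub_uniq; case: (listing_src (N n)).
- by move=> n; case: (listing_tgt (N n)).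
- move=> x; rewrite mem_pmap_sub.
  by case: (listing_src (N (w x))) => _ ms _; apply: ms; rewrite -wE /N; lia.
- by move=> y; case: (listing_tgt (N (wt8 y))) => _ mt _; apply: mt; rewrite /N; lia.
- move=> n.
  (* Even weight with half equal to n means weight 2n, so the count can be made over all tuples. *)
  have -> : count (fun x => w x == n) (s n)
      = count (fun y => wt4 y == n.*2) (src_list (N n).*2).
    rewrite -(count_map val (fun y => (wt4 y)./2 == n)) (pmap_filter (insubK _)).
    rewrite (eq_filter (isSome_insub _)) count_filter; apply: eq_count => y /=.
    by lia.
  (* As integers the two counts are coefficient 2n of F and coefficient n of F^2. *)
  apply/eqP; rewrite -eqz_nat -!natz.
  rewrite (listing_count _ (listing_src _)) (listing_count _ (listing_tgt _)).
  by rewrite -coef_even_poly (even_oddprod_dprod (K := n.+1)).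
by exists f; split=> // x; rewrite vf wE.
Qed.

Local Close Scope ring_scope.

Theorem theorem2p10 :
  (exists f : Src -> Tgt,
      bijective f /\ forall x : Src, (2 * wt8 (f x))%N = wt4 (val x))
  /\ convolutive 2 P1246.
Proof. by split; [exact: weight_halving_bijection | exact: P1246_convolutive]. Qed.
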